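(* If $\{X_i\}_{i=1}^{\infty}$ is a sequence of Peng-independent random variables on the upper probability space $(\Omega,\mathcal{F},\mathcal{P},\mathbb{V})$, then it is a sequence of negatively associated random variables.
   Context: Let $(\Omega,\mathcal{F})$ be a measurable space and $\mathcal{P}$ a nonempty set of probability measures on it. For $A\in\mathcal{F}$ set $\mathbb{V}(A)=\sup_{P\in\mathcal{P}}P(A)$. For a random variable $X$ with $E_P[|X|]<\infty$ for all $P\in\mathcal{P}$, set $\mathbb{E}[X]=\sup_{P\in\mathcal{P}}E_P[X]$, where $E_P$ is the classical expectation under $P$. $(\Omega,\mathcal{F},\mathcal{P},\mathbb{V})$ is called the upper probability space. $C_{l,Lip}(\mathbb{R}^k)$ is the set of functions $\varphi:\mathbb{R}^k\to\mathbb{R}$ such that, for some $C>0$ and $m\in\mathbb{N}$, $|\varphi(x)-\varphi(y)|\le C(1+|x|^m+|y|^m)|x-y|$ for all $x,y\in\mathbb{R}^k$. A random variable $Y$ is Peng-independent from a random vector $X=(X_1,\dots,X_n)$ if for each $\varphi\in C_{l,Lip}(\mathbb{R}^{n+1})$ (the expectations involved being assumed to exist) one has $\mathbb{E}[\varphi(X,Y)]=\mathbb{E}\big[\mathbb{E}[\varphi(x,Y)]\big|_{x=X}\big]$. A sequence $\{X_i\}_{i=1}^{\infty}$ is Peng-independent if $X_{n+1}$ is Peng-independent from $(X_1,\dots,X_n)$ for every $n\ge 1$. Let $C_b^+(\mathbb{R})$ be the set of nonnegative bounded continuous functions on $\mathbb{R}$. Functions have ''the same monotonicity'' if they are all nondecreasing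 or all nonincreasing. A sequence $\{X_i\}_{i=1}^{\infty}$ of random variables is negatively associated if for every $n\ge 1$ and every sequence $\{f_i\}_{i=1}^{\infty}\subset C_b^+(\mathbb{R})$ with the same monotonicity, $\mathbb{E}\left[\prod_{i=1}^{n+1}f_i(X_i)\right]\le \mathbb{E}\left[\prod_{i=1}^{n}f_i(X_i)\right]\,\mathbb{E}[f_{n+1}(X_{n+1})]$. *)

(* Defs.v *)
From HB Require Import structures.
From mathcomp Require Import all_boot all_order all_algebra.
From mathcomp Require Import all_classical all_reals all_analysis.

Set Implicit Arguments.
Unset Strict Implicit.
Unset Printing Implicit Defensive.

Import Order.TTheory GRing.Theory Num.Theory.
Import numFieldNormedType.Exports.

Local Open Scope classical_set_scope.
Local Open Scope ring_scope.

Section upper_expectation.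
Context d (T : measurableType d) (R : realType).
Variable calP : set (probability T R).

Definition upper_expectation (X : T -> R) : \bar R :=
  ereal_sup [set 'E_P[X]%E | P in calP].

(* Each 'E_P[|X|] is finite; the supremum itself may still be +oo. *)
Definition upper_expectation_exists (X : T -> R) : Prop :=
  forall P : probability T R, calP P -> P.-integrable setT (EFin \o X).

End upper_expectation.

(* The library norm on row vectors is the sup norm; this is the Euclidean one. *)
Definition enorm (R : realType) k (x : 'rV[R]_k) : R :=
  Num.sqrt (\sum_(i < k) x ord0 i ^+ 2).

Definition C_lLip (R : realType) k (phi : 'rV[R]_k -> R) : Prop :=
  exists (C : R) (m : nat), 0 < C /\
    forall x y : 'rV[R]_k,
      `|phi x - phi y| <= C * (1 + enorm x ^+ m + enorm y ^+ m) * enorm (x - y).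

Section Peng_independence.
Context d (T : measurableType d) (R : realType).
Variable calP : set (probability T R).

Definition random_vector n (X : 'I_n -> {mfun T >-> R}) (w : T) : 'rV[R]_n :=
  \row_(i < n) X i w.

Definition vec_snoc n (x : 'rV[R]_n) (y : R) : 'rV[R]_(n + 1) :=
  row_mx x y%:M.

(* The equality is required of those phi for which all three expectations
   exist. Since E[phi(x, Y)] is to be a real function of x, into which X is then
   substituted, it has to be finite for every x; [fine] is only used then. *)
Definition Peng_independent_from n (Y : {mfun T >-> R})
    (X : 'I_n -> {mfun T >-> R}) : Prop :=
  forall phi : 'rV[R]_(n + 1) -> R, C_lLip phi ->
    let joint := fun w => phi (vec_snoc (random_vector X w) (Y w)) in
    let section_Y := fun (x : 'rV[R]_n) w => phi (vec_snoc x (Y w)) in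
    let inner := fun x => fine (upper_expectation calP (section_Y x)) in
    upper_expectation_exists calP joint ->
    (forall x, upper_expectation_exists calP (section_Y x)) ->
    (forall x, upper_expectation calP (section_Y x) \is a fin_num) ->
    upper_expectation_exists calP (inner \o random_vector X) ->
    upper_expectation calP joint =
    upper_expectation calP (inner \o random_vector X).

(* Sequences are indexed from 0: the (i+1)-st variable is [X i]. *)
Definition Peng_independent_sequence (X : nat -> {mfun T >-> R}) : Prop :=
  forall n, (1 <= n)%N -> Peng_independent_from (X n) (fun i : 'I_n => X i).

End Peng_independence.

Definition Cb_plus (R : realType) (f : R -> R) : Prop :=
  [/\ continuous f, forall x, 0 <= f x & exists M : R, forall x, f x <= M].

Definition same_monotonicity (R : realType) (f : nat -> R -> R) : Prop :=
  (forall i, {homo f i : x y / x <= y}) \/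
  (forall i, {homo f i : x y /~ x <= y}).

Definition negatively_associated d (T : measurableType d) (R : realType)
    (calP : set (probability T R)) (X : nat -> {mfun T >-> R}) : Prop :=
  forall n, (1 <= n)%N -> forall f : nat -> R -> R,
    (forall i, Cb_plus (f i)) -> same_monotonicity f ->
    (upper_expectation calP (fun w => (\prod_(i < n.+1) f i (X i w))%R) <=
     upper_expectation calP (fun w => (\prod_(i < n) f i (X i w))%R) *
     upper_expectation calP (fun w => f n (X n w)))%E.

(* Main.v *)
Require Import Defs.
From mathcomp Require Import all_boot all_order all_algebra.
From mathcomp Require Import all_classical all_reals all_analysis.
From mathcomp Require Import measurable_realfun ring lra.

Set Implicit Arguments.
Unset Strict Implicit.
Unset Printing Implicit Defensive.

Import Order.TTheory GRing.Theory Num.Theory.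
Import numFieldNormedType.Exports.

Local Open Scope classical_set_scope.
Local Open Scope ring_scope.

(** If every f_i is nonnegative, bounded and Lipschitz, then the function
    (x, y) |-> f_0(x_0) ... f_(n-1)(x_(n-1)) f_n(y) is bounded and Lipschitz,
    hence an admissible test function for Peng independence.  Its sections
    are y |-> c f_n(y) with c >= 0, and a sublinear expectation is positively
    homogeneous, so that Peng independence gives an equality:
      E[f_0(X_0) ... f_n(X_n)] = E[f_0(X_0) ... f_(n-1)(X_(n-1))] E[f_n(X_n)]
    ([Peng_factorization]).

    It remains to reach functions that are only continuous.  Truncating the
    X_i is no option, because calP need not be tight and mass may escape to
    infinity; the approximation has to be uniform on the whole line.  This is
    where monotonicity enters: a bounded continuous monotone function on the
    line is uniformly continuous ([monotone_almost_lipschitz]), so its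
    infimal convolution with K |x - y| is, for large K, a Lipschitz function g
    with 0 <= g <= f <= g + e ([lipschitz_minorant]).  Replacing each f_i by
    such a g_i on the left-hand side costs O(e) since everything is bounded
    ([prod_le_prod_add]), and on the right-hand side g_i <= f_i only helps.
    Letting e tend to 0 gives the inequality. *)

(** * Lipschitz approximation of monotone functions from below *)

Section lipschitz_minorant.
Variable R : realType.
Implicit Types (f g : R -> R) (e K M : R).

(** Uniform continuity of a bounded function, in the additive form that the
    infimal convolution needs.  Only a rise of f by more than e has to be paid
    for by K |x - y|.  Cut the range of f into steps of height e / 2: such a
    rise crosses a whole step, so x and y lie on both sides of the interval
    on which f climbs that step, and |x - y| is at least its length.  There
    are finitely many steps, whence the induction. *)
Lemma nondecreasing_almost_lipschitz f e M : continuous f ->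
    {homo f : x y / x <= y} -> (forall x, 0 <= f x) -> (forall x, f x <= M) ->
  0 < e -> exists2 K, 0 <= K & forall x y, f x <= f y + e + K * `|x - y|.
Proof.
move=> cf ndf f0 fM e0.
pose h := e / 2.
have h0 : 0 < h by rewrite /h; lra.
suff levels N : exists2 K, 0 <= K &
    forall x y, f x <= N%:R * h -> f x <= f y + e + K * `|x - y|.
  have [K K0 HK] := levels (Num.bound (M / h)).
  exists K => // x y; apply: HK; rewrite (le_trans (fM x))// -ler_pdivrMr//.
  by rewrite ltW// archi_boundP// divr_ge0 ?(ltW h0)// (le_trans (f0 x)).
elim: N => [|N [K K0 HK]].
  exists 0 => // x y; rewrite mul0r => fx; rewrite mul0r addr0.
  by have := f0 y; lra.
(* The step between N h - h and N h: is it crossed at all? *)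
have [[[x0 y0] /= [fx0 fy0]]|no_crossing] :=
    pselect (exists p : R * R, N%:R * h < f p.1 /\ f p.2 < N%:R * h - h); last first.
  exists K => // x y fx.
  have Kxy : 0 <= K * `|x - y| by rewrite mulr_ge0.
  have [|fNx] := leP (f x) (N%:R * h); first exact: HK.
  have [fyN|] := ltP (f y) (N%:R * h - h).
    by exfalso; apply: no_crossing; exists (x, y).
  move: fx; rewrite -natr1 mulrDl mul1r /h; lra.
have y0x0 : y0 <= x0.
  by rewrite leNgt; apply/negP => /ltW/ndf; lra.
have cf' : {within `[y0, x0], continuous f} by exact: continuous_subspaceT.
have fyx : f y0 <= f x0 by exact: ndf.
(* The step is climbed between a and b. *)
have [a _ fa] : exists2 c, c \in `[y0, x0] & f c = N%:R * h - h.
  apply: IVT => //; rewrite min_l// max_r//; apply/andP; split; lra.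
have [b _ fb] : exists2 c, c \in `[y0, x0] & f c = N%:R * h.
  apply: IVT => //; rewrite min_l// max_r//; apply/andP; split; lra.
have ab : a < b by rewrite ltNge; apply/negP => /ndf; lra.
have ba0 : 0 < b - a by lra.
(* f x is at most (N + 1) h here, and L (b - a) is exactly that. *)
pose L := (N.+1%:R * h) / (b - a).
have L0 : 0 <= L by rewrite /L divr_ge0 ?mulr_ge0 ?ltW.
exists (K + L) => [|x y fx]; first exact: addr_ge0.
have Kxy : 0 <= K * `|x - y| by rewrite mulr_ge0.
have Lxy : 0 <= L * `|x - y| by rewrite mulr_ge0.
rewrite mulrDl.
have [fxN|fNx] := leP (f x) (N%:R * h).
  by have := HK x y fxN; lra.
have [fyN|] := ltP (f y) (N%:R * h - h); last first.
  move: fx; rewrite -natr1 mulrDl mul1r /h; lra.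
have bx : b < x by rewrite ltNge; apply/negP => /ndf; lra.
have ya : y < a by rewrite ltNge; apply/negP => /ndf; lra.
have : N.+1%:R * h <= L * `|x - y|.
  rewrite -[leLHS](@divfK _ (b - a)) ?gt_eqF// ler_wpM2l//.
  by rewrite (le_trans _ (ler_norm _))//; lra.
by have := f0 y; lra.
Qed.

Lemma monotone_almost_lipschitz f e : Cb_plus f ->
    {homo f : x y / x <= y} \/ {homo f : x y /~ x <= y} ->
  0 < e -> exists2 K, 0 <= K & forall x y, f x <= f y + e + K * `|x - y|.
Proof.
move=> [cf f0 [M fM]] [ndf|nif] e0.
  exact: nondecreasing_almost_lipschitz fM e0.
(* The reflection M - f exchanges the roles of x and y. *)
have [|x y xy|x|x||K K0 HK] := @nondecreasing_almost_lipschitz (fun x => M - f x) e M.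
- by move=> x; apply: cvgB; [exact: cvg_cst|exact: cf].
- by rewrite lerB// nif.
- by rewrite subr_ge0.
- by rewrite gerBl.
- exact: e0.
- by exists K => // x y; have := HK y x; rewrite distrC; lra.
Qed.

(** The minorant is the infimal convolution of f with K |.|: being an infimum
    of K-Lipschitz functions of x it is K-Lipschitz, the choice y = x shows
    that it lies below f, and the hypothesis says that every competitor is at
    least f x - e. *)
Lemma lipschitz_minorant f e K : (forall x, 0 <= f x) -> 0 <= K ->
    (forall x y, f x <= f y + e + K * `|x - y|) ->
  exists g, [/\ forall x, 0 <= g x <= f x, forall x, f x <= g x + e &
    forall x y, `|g x - g y| <= K * `|x - y|].
Proof.
move=> f0 K0 HK.
pose S x := [set f y + K * `|x - y| | y in setT].
pose g x := inf (S x).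
have lbS x : lbound (S x) 0.
  by move=> _ [y _ <-]; rewrite addr_ge0// mulr_ge0.
have hlbS x : has_lbound (S x) by exists 0.
have S0 x : S x !=set0 by exists (f x + K * `|x - x|); exists x.
have gle x y : g x <= f y + K * `|x - y| by apply: ge_inf => //; exists y.
have lip x y : g x - g y <= K * `|x - y|.
  suff : g x - K * `|x - y| <= g y by lra.
  apply: lb_le_inf => // _ [z _ <-].
  have := gle x z.
  have : K * `|x - z| <= K * (`|x - y| + `|y - z|).
    by rewrite ler_wpM2l// ler_distD.
  by rewrite mulrDr; lra.
exists g; split => [x|x|x y].
- rewrite lb_le_inf//=; have := gle x x.
  by rewrite subrr normr0 mulr0 addr0.
- suff : f x - e <= g x by lra.
  by apply: lb_le_inf => // _ [y _ <-]; have := HK x y; lra.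
- by rewrite ler_norml lip andbT lerNl opprB distrC lip.
Qed.

Lemma lipschitz_continuous g K : 0 <= K ->
  (forall x y, `|g x - g y| <= K * `|x - y|) -> continuous g.
Proof.
move=> K0 lip x; apply/cvgrPdist_lt => e e0.
have K1 : 0 < K + 1 by lra.
have eK0 : 0 < e / (K + 1) by rewrite divr_gt0.
apply: filterS (nbhsx_ballx x _ eK0) => y.
rewrite /ball /= ltr_pdivlMr// => lt_e.
apply: (le_lt_trans (lip x y)); apply: le_lt_trans lt_e.
by rewrite mulrC ler_wpM2l//; lra.
Qed.

End lipschitz_minorant.

(** * Perturbation of products *)

(** The constant C depends on the bounds M and on n only, so that the error
    C * e can be made small after M and n are known. *)
Lemma prod_le_prod_add (R : realType) (M : nat -> R) n : (forall i, 0 <= M i) ->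
  exists2 C, 0 <= C & forall (a b : nat -> R) e, 0 <= e ->
    (forall i, 0 <= a i <= b i) -> (forall i, b i <= M i) ->
    (forall i, b i <= a i + e) ->
    \prod_(i < n) b i <= \prod_(i < n) a i + C * e.
Proof.
move=> M0; elim: n => [|n [C C0 IH]].
  by exists 0 => // a b e *; rewrite !big_ord0 mul0r addr0.
exists (C * M n + \prod_(i < n) M i) => [|a b e e0 ab bM bae].
  by rewrite addr_ge0 ?mulr_ge0// prodr_ge0.
rewrite !big_ord_recr /=.
have {}IH := IH a b e e0 ab bM bae.
set A := \prod_(i < n) a i in IH *.
have A0 : 0 <= A by rewrite prodr_ge0// => i _; have /andP[] := ab i.
have AM : A <= \prod_(i < n) M i.
  apply: ler_prod => i _; have /andP[-> /= h] := ab i.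
  exact: le_trans h (bM i).
have b0 : 0 <= b n by have := ab n; lra.
have h1 : \prod_(i < n) b i * b n <= (A + C * e) * b n by exact: ler_wpM2r.
have h2 : A * b n <= A * (a n + e) by exact: ler_wpM2l.
have h3 : C * e * b n <= C * e * M n by rewrite ler_wpM2l// mulr_ge0.
have h4 : A * e <= (\prod_(i < n) M i) * e by exact: ler_wpM2r.
lra.
Qed.

(** * Products of bounded Lipschitz functions as test functions *)

Section bounded_lipschitz.
Variables (R : realType) (k : nat).

(** Boundedness is part of the notion because it is what makes the class
    stable under products; [MK] is the pair of the bound and the Lipschitz
    constant. *)
Definition bounded_lipschitz (phi : 'rV[R]_k -> R) :=
  exists2 MK : R * R, 0 <= MK.1 /\ 0 <= MK.2 &
    (forall x, `|phi x| <= MK.1) /\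
    (forall x y, `|phi x - phi y| <= MK.2 * enorm (x - y)).

Lemma enorm_ge0 (x : 'rV[R]_k) : 0 <= enorm x.
Proof. exact: sqrtr_ge0. Qed.

Lemma coord_le_enorm (x : 'rV[R]_k) i : `|x ord0 i| <= enorm x.
Proof.
rewrite -sqrtr_sqr ler_wsqrtr// (bigD1 i)//= lerDl sumr_ge0// => j _.
exact: sqr_ge0.
Qed.

(** A Lipschitz function meets the growth condition with exponent 0; the
    constant is [K + 1] because it has to be positive. *)
Lemma bounded_lipschitz_C_lLip phi : bounded_lipschitz phi -> C_lLip phi.
Proof.
move=> [[M K] /= [M0 K0] [_ lip]]; exists (K + 1), 0%N; split; first by lra.
move=> x y; rewrite !expr0 (le_trans (lip x y))// ler_wpM2r ?enorm_ge0//.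
lra.
Qed.

Lemma bounded_lipschitz_coord (g : R -> R) M K i : 0 <= K ->
    (forall x, `|g x| <= M) -> (forall x y, `|g x - g y| <= K * `|x - y|) ->
  bounded_lipschitz (fun x => g (x ord0 i)).
Proof.
move=> K0 gM lip; exists (M, K) => /=.
  by split=> //; exact: le_trans (gM 0).
split=> [x|x y]; first exact: gM.
rewrite (le_trans (lip _ _))// ler_wpM2l//.
by have := coord_le_enorm (x - y) i; rewrite !mxE.
Qed.

Lemma bounded_lipschitzM phi psi : bounded_lipschitz phi ->
  bounded_lipschitz psi -> bounded_lipschitz (fun x => phi x * psi x).
Proof.
move=> [[M K] /= [M0 K0] [bphi lphi]] [[N L] /= [N0 L0] [bpsi lpsi]].
exists (M * N, M * L + N * K) => /=.
  by split; rewrite ?addr_ge0 ?mulr_ge0.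
split=> [x|x y]; first by rewrite normrM ler_pM.
have -> : phi x * psi x - phi y * psi y =
    phi x * (psi x - psi y) + psi y * (phi x - phi y) by ring.
rewrite (le_trans (ler_normD _ _))// !normrM mulrDl -!mulrA.
by rewrite lerD// ler_pM.
Qed.

Lemma bounded_lipschitz_prod n (F : 'I_n -> 'rV[R]_k -> R) :
    (forall i, bounded_lipschitz (F i)) ->
  bounded_lipschitz (fun x => \prod_(i < n) F i x).
Proof.
elim: n F => [|n IH] F blF.
  exists (1, 0) => //=; split => [x|x y]; first by rewrite big_ord0 normr1.
  by rewrite !big_ord0 subrr normr0 mul0r.
under eq_fun do rewrite big_ord_recr /=.
by apply: bounded_lipschitzM => //; exact: IH.
Qed.

End bounded_lipschitz.

(** * The upper expectation on nonnegative functions *)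

Section upper_expectation_theory.
Context d (T : measurableType d) (R : realType).
Variable calP : set (probability T R).
Local Open Scope ereal_scope.
Implicit Types X Y : T -> R.

Lemma upper_expectation_leD X Y (e : R) :
    measurable_fun setT X -> measurable_fun setT Y ->
    (forall w, 0 <= X w)%R -> (forall w, 0 <= Y w)%R -> (0 <= e)%R ->
    (forall w, X w <= Y w + e)%R ->
  upper_expectation calP X <= upper_expectation calP Y + e%:E.
Proof.
move=> mX mY X0 Y0 e0 XY; apply: ge_ereal_sup => _ [P calPP <-].
have EXY : 'E_P[X] <= 'E_P[Y] + e%:E.
  rewrite -(expectation_cst P e) unlock -ge0_integralD//=.
  - apply: ge0_le_integral => //=.
    + by move=> w _; rewrite lee_fin.
    + exact/measurable_EFinP.
    + by apply/measurable_EFinP; exact: measurable_funD.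
    + by move=> w _; rewrite lee_fin.
  - by move=> w _; rewrite lee_fin.
  - exact/measurable_EFinP.
apply: (le_trans EXY); rewrite leeD2r//.
by apply: ereal_sup_ubound; exists P.
Qed.

Lemma upper_expectation_le X Y :
    measurable_fun setT X -> measurable_fun setT Y ->
    (forall w, 0 <= X w)%R -> (forall w, X w <= Y w)%R ->
  upper_expectation calP X <= upper_expectation calP Y.
Proof.
move=> mX mY X0 XY; rewrite -[leRHS]adde0.
apply: upper_expectation_leD => // w; last by rewrite addr0.
exact: le_trans (X0 w) (XY w).
Qed.

Lemma upper_expectation_exists_bounded X (M : R) :
    measurable_fun setT X -> (forall w, `|X w| <= M)%R ->
  upper_expectation_exists calP X.
Proof.
move=> mX XM P _; apply: measurable_bounded_integrable => //.
  by rewrite -ge0_fin_numE// fin_num_measure.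
exists M; split; first exact: num_real.
by move=> N MN w _ /=; exact: le_trans (XM w) (ltW MN).
Qed.

Hypothesis calP0 : calP !=set0.

Lemma upper_expectationZl X (c : R) : measurable_fun setT X ->
    (forall w, 0 <= X w)%R -> (0 <= c)%R ->
  upper_expectation calP (fun w => c * X w)%R = c%:E * upper_expectation calP X.
Proof.
move=> mX X0 c0; rewrite /upper_expectation -ereal_supZl//; last first.
  by have [P calPP] := calP0; apply/set0P; exists 'E_P[X], P.
rewrite image_comp; congr ereal_sup; apply: eq_imagel => P _ /=.
rewrite unlock -ge0_integralZl//.
- exact/measurable_EFinP.
- by move=> w _; rewrite lee_fin.
Qed.

Lemma upper_expectation_ge0 X : (forall w, 0 <= X w)%R ->
  0 <= upper_expectation calP X.
Proof.
move=> X0; have [P calPP] := calP0.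
apply: (le_trans (expectation_ge0 P X0)).
by apply: ereal_sup_ubound; exists P.
Qed.

Lemma upper_expectation_fin_num X (M : R) : measurable_fun setT X ->
    (forall w, 0 <= X w)%R -> (forall w, X w <= M)%R ->
  upper_expectation calP X \is a fin_num.
Proof.
move=> mX X0 XM; rewrite ge0_fin_numE ?upper_expectation_ge0//.
apply: (@le_lt_trans _ _ M%:E); last exact: ltry.
apply: ge_ereal_sup => _ [P _ <-]; rewrite -(expectation_cst P M).
apply: expectation_le => //.
  by move=> w; exact: le_trans (X0 w) (XM w).
exact: aeW.
Qed.

End upper_expectation_theory.

(** * Factorization for Lipschitz functions *)

Section peng_factorization.
Context d (T : measurableType d) (R : realType).
Variables (calP : set (probability T R)) (calP0 : calP !=set0).

Lemma prod_row_snoc n (g : nat -> R -> R) (x : 'rV[R]_n) y :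
  \prod_(i < n + 1) g i (vec_snoc x y ord0 i) =
  \prod_(i < n) g i (x ord0 i) * g n y.
Proof.
rewrite big_split_ord big_ord1 /= addn0 row_mxEr mxE eqxx mulr1n; congr (_ * _).
by apply: eq_bigr => i _; rewrite row_mxEl.
Qed.

(** Peng independence is applied to the product test function.  Freezing x
    turns the product over i < n into a nonnegative constant, which leaves the
    expectation of g n (X n) as a factor; that factor is a finite nonnegative
    constant and leaves the outer expectation in turn. *)
Lemma Peng_factorization n (X : nat -> {mfun T >-> R}) (g : nat -> R -> R)
    (M K : nat -> R) :
  Peng_independent_from calP (X n) (fun i : 'I_n => X i) ->
  (forall i, 0 <= K i) -> (forall i x, 0 <= g i x <= M i) ->
  (forall i x y, `|g i x - g i y| <= K i * `|x - y|) ->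
  upper_expectation calP (fun w => \prod_(i < n.+1) g i (X i w)) =
  (upper_expectation calP (fun w => (\prod_(i < n) g i (X i w))%R) *
   upper_expectation calP (fun w => g n (X n w)))%E.
Proof.
move=> indep K0 gM lip.
have g0 i x : 0 <= g i x by have /andP[] := gM i x.
have mg i : measurable_fun setT (fun w => g i (X i w)).
  apply: measurableT_comp => //; apply: continuous_measurable_fun.
  exact: lipschitz_continuous (lip i).
have p0 k (z : nat -> R) : 0 <= \prod_(i < k) g i (z i).
  by rewrite prodr_ge0.
have pM k (z : nat -> R) : \prod_(i < k) g i (z i) <= \prod_(i < k) M i.
  exact: ler_prod.
have mp k : measurable_fun setT (fun w => \prod_(i < k) g i (X i w)).
  by apply: measurable_prod => i _; exact: mg.
pose phi (z : 'rV[R]_(n + 1)) := \prod_(i < n + 1) g i (z ord0 i).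
have phi_bl : bounded_lipschitz phi.
  apply: bounded_lipschitz_prod => i.
  apply: (@bounded_lipschitz_coord _ _ (g i) (M i) (K i)) => // x.
  by rewrite ger0_norm//; have /andP[] := gM i x.
set U := upper_expectation calP.
have Ufin : U (fun w => g n (X n w)) \is a fin_num.
  apply: (upper_expectation_fin_num calP0 (M := M n)) => // w.
  by have /andP[] := gM n (X n w).
have U0 := upper_expectation_ge0 calP0 (fun w => g0 n (X n w)).
have sectionE x : (fun w => phi (vec_snoc x (X n w))) =
    (fun w => \prod_(i < n) g i (x ord0 i) * g n (X n w)).
  by apply/funext => w; rewrite /phi prod_row_snoc.
have prodE w : \prod_(i < n) g i (random_vector (fun i : 'I_n => X i) w ord0 i)
    = \prod_(i < n) g i (X i w).
  by apply: eq_bigr => i _; rewrite mxE.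
have px0 (x : 'rV[R]_n) : 0 <= \prod_(i < n) g i (x ord0 i) by rewrite prodr_ge0.
have UsectionE x : U (fun w => phi (vec_snoc x (X n w))) =
    ((\prod_(i < n) g i (x ord0 i))%:E * U (fun w => g n (X n w)))%E.
  by rewrite sectionE /U upper_expectationZl.
have jointE : (fun w => phi (vec_snoc (random_vector (fun i : 'I_n => X i) w)
    (X n w))) = (fun w => \prod_(i < n.+1) g i (X i w)).
  by apply/funext => w; rewrite /phi prod_row_snoc prodE big_ord_recr.
have innerE : (fun x => fine (U (fun w => phi (vec_snoc x (X n w))))) \o
    random_vector (fun i : 'I_n => X i) =
    (fun w => fine (U (fun w => g n (X n w))) * \prod_(i < n) g i (X i w)).
  by apply/funext => w /=; rewrite UsectionE fineM// prodE mulrC.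
have /= := indep phi (bounded_lipschitz_C_lLip phi_bl).
rewrite jointE innerE /U => ->.
- rewrite upper_expectationZl ?fine_ge0// => [|w]; last exact: (p0 n (X ^~ w)).
  by rewrite fineK// muleC.
- apply: (upper_expectation_exists_bounded (M := \prod_(i < n.+1) M i)) => // w.
  by rewrite ger0_norm ?(p0 _ (X ^~ w))// (pM _ (X ^~ w)).
- move=> x; rewrite sectionE.
  apply: (upper_expectation_exists_bounded
      (M := \prod_(i < n) g i (x ord0 i) * M n)).
    exact: measurable_funM.
  by move=> w; rewrite ger0_norm ?mulr_ge0// ler_wpM2l//; have /andP[] := gM n (X n w).
- by move=> x; rewrite -/(U _) UsectionE fin_numM.
- apply: (upper_expectation_exists_bounded
      (M := fine (U (fun w => g n (X n w))) * \prod_(i < n) M i)).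
    exact: measurable_funM.
  move=> w; rewrite ger0_norm ?mulr_ge0 ?fine_ge0 ?(p0 _ (X ^~ w))//.
  by rewrite ler_wpM2l ?fine_ge0// (pM _ (X ^~ w)).
Qed.

End peng_factorization.

Theorem proposition3p4 (d : measure_display) (T : measurableType d)
  (R : realType) (calP : set (probability T R)) (hcalP : calP !=set0)
  (X : nat -> {mfun T >-> R}) (hX : Peng_independent_sequence calP X) :
  negatively_associated calP X.
Proof.
move=> n n1 f fCb fmono.
have f0 i x : 0 <= f i x by have [] := fCb i.
have cf i : continuous (f i) by have [] := fCb i.
have f_bounded i : exists m, forall x, f i x <= m by have [] := fCb i.
have [M fM] := choice f_bounded.
have fmono1 i : {homo f i : x y / x <= y} \/ {homo f i : x y /~ x <= y}.
  by case: fmono => h; [left|right].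
have mf i : measurable_fun setT (fun w => f i (X i w)).
  by apply: measurableT_comp => //; exact: continuous_measurable_fun.
have M0 i : 0 <= M i by exact: le_trans (f0 i 0) (fM i 0).
have [C C0 HC] := prod_le_prod_add n.+1 M0.
apply/lee_addgt0Pr => eta eta0.
(* C may be 0, hence the division by C + 1; still C * e <= eta. *)
have C1 : 0 < C + 1 by lra.
pose e := eta / (C + 1).
have e0 : 0 < e by rewrite divr_gt0.
have approx i : exists gK : (R -> R) * R,
    [/\ 0 <= gK.2, forall x, 0 <= gK.1 x <= f i x,
     forall x, f i x <= gK.1 x + e &
     forall x y, `|gK.1 x - gK.1 y| <= gK.2 * `|x - y|].
  have [K K0 HK] := monotone_almost_lipschitz (fCb i) (fmono1 i) e0.
  have [g [g1 g2 g3]] := lipschitz_minorant (f0 i) K0 HK.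
  by exists (g, K).
have [gK gKP] := choice approx.
pose g i := (gK i).1.
have gf i x : 0 <= g i x <= f i x by have [_ + _ _] := gKP i; apply.
have g0 i x : 0 <= g i x by have /andP[] := gf i x.
have mg i : measurable_fun setT (fun w => g i (X i w)).
  apply: measurableT_comp => //; apply: continuous_measurable_fun.
  by have [K0 _ _ lip] := gKP i; exact: lipschitz_continuous lip.
have factorE := @Peng_factorization _ T R calP hcalP n X g M (fun i => (gK i).2)
  (hX n n1).
apply: (@le_trans _ _ 
  (upper_expectation calP (fun w => \prod_(i < n.+1) g i (X i w))%R + eta%:E)%E).
  apply: upper_expectation_leD => [||w|w||w].
  - by apply: measurable_prod => i _; exact: mf.
  - by apply: measurable_prod => i _; exact: mg.
  - by rewrite prodr_ge0.
  - by rewrite prodr_ge0.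
  - exact: ltW.
  - have := HC (fun i => g i (X i w)) (fun i => f i (X i w)) e (ltW e0).
    move=> /(_ (fun i => gf i _) (fun i => fM i _)) /= h.
    apply: (le_trans (h _)) => [i|]; first by have [_ _ + _] := gKP i; apply.
    rewrite lerD2l /e mulrCA ler_piMr ?(ltW eta0)// ler_pdivrMr//; lra.
rewrite leeD2r// factorE => [|i|i x|i x y]; last 3 first.
- by have [] := gKP i.
- by have /andP[-> /= h] := gf i x; exact: le_trans h (fM i x).
- by have [_ _ _ +] := gKP i; apply.
apply: lee_pmul.
- by apply: upper_expectation_ge0 => // w; rewrite prodr_ge0.
- exact: upper_expectation_ge0.
- apply: upper_expectation_le => [||w|w].
  + by apply: measurable_prod => i _; exact: mg.
  + by apply: measurable_prod => i _; exact: mf.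
  + by rewrite prodr_ge0.
  + exact: ler_prod.
- by apply: upper_expectation_le => // w; have /andP[] := gf n (X n w).
Qed.
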